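(* Let $d\ge 3$. There are constants $M_1,M_2\in(0,\infty)$ depending only on $d$ such that for every Borel measurable function $V\colon\mathbb{R}^d\to\mathbb{R}$, $$M_1\,\|V\|_{K}\le \|S(V)\|_\infty\le M_2\,\|V\|_{K}$$ (as an inequality in $[0,\infty]$).
   Context: For $x,y\in\mathbb{R}^d$ and $t>0$ let $g(t,x,y)=(4\pi t)^{-d/2}e^{-|y-x|^2/(4t)}$. For Borel measurable $V\colon\mathbb{R}^d\to\mathbb{R}$ define $$S(V,t,x,y)=\int_0^t\int_{\mathbb{R}^d}\frac{g(s,x,z)\,g(t-s,z,y)}{g(t,x,y)}\,|V(z)|\,dz\,ds,\qquad \|S(V)\|_\infty=\sup_{t>0,\;x,y\in\mathbb{R}^d}S(V,t,x,y).$$ For $d\ge 3$ and $x,y\in\mathbb{R}^d$ (with $x\neq 0$) let $$K(x,y)=\frac{e^{-(|x||y|-x\cdot y)/2}}{|x|^{d-2}}\,(1+|x||y|)^{d/2-3/2},$$ where $x\cdot y$ is the usual scalar product, and $$K(V,x,y)=\int_{\mathbb{R}^d}|V(z)|\,K(z-x,y)\,dz,\qquad \|V\|_K=\sup_{x,y\in\mathbb{R}^d}K(V,x,y).$$ *)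

(* Defs.v *)
From HB Require Import structures.
From mathcomp Require Import all_boot all_order all_algebra.
From mathcomp Require Import all_classical all_reals all_analysis.

Set Implicit Arguments.
Unset Strict Implicit.
Unset Printing Implicit Defensive.

Import Order.TTheory GRing.Theory Num.Theory.
Import numFieldNormedType.Exports.

Local Open Scope classical_set_scope.
Local Open Scope ring_scope.

Section tuple_cons.
Context d (T : measurableType d) (n : nat).

Definition tcons (p : T * n.-tuple T) : n.+1.-tuple T :=
  [the n.+1.-tuple T of p.1 :: p.2].

Definition tuncons (t : n.+1.-tuple T) : T * n.-tuple T :=
  (thead t, [tuple of behead t]).

Lemma measurable_tcons : measurable_fun setT tcons.
Proof. exact: measurable_cons. Qed.

Lemma measurable_tuncons : measurable_fun setT tuncons.
Proof.
apply/measurable_fun_pairP; split; first exact: measurable_tnth.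
exact: measurable_behead.
Qed.

Lemma tconsK : cancel tcons tuncons.
Proof.
by move=> [x t]; rewrite /tuncons /tcons; congr pair; apply: val_inj.
Qed.

End tuple_cons.

Lemma sigma_finite_product d1 d2 (T1 : measurableType d1)
    (T2 : measurableType d2) (R : realType)
    (m1 : {sigma_finite_measure set T1 -> \bar R})
    (m2 : {sigma_finite_measure set T2 -> \bar R}) :
  sigma_finite setT (m1 \x m2)%E.
Proof.
have /sigma_finiteP[F [TF ndF Foo]] := sigma_finiteT m1.
have /sigma_finiteP[G [TG ndG Goo]] := sigma_finiteT m2.
exists (fun n => F n `*` G n).
  rewrite -setXTT TF TG predeqE => -[x y]; split.
    move=> [/= [n _ Fnx] [k _ Gky]]; exists (maxn n k) => //; split.
    - by move: x Fnx; exact/subsetPset/ndF/leq_maxl.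
    - by move: y Gky; exact/subsetPset/ndG/leq_maxr.
  by move=> [n _ []/= ? ?]; split; exists n.
move=> k; have [? ?] := Foo k; have [? ?] := Goo k.
split; first exact: measurableX.
by rewrite product_measure1E// lte_mul_pinfty// ge0_fin_numE.
Qed.

Section cons_measure.
Local Open Scope ereal_scope.
Context d (T : measurableType d) (R : realType) (n : nat).
Variable nu : {sigma_finite_measure set T -> \bar R}.
Variable mu : {sigma_finite_measure set (n.-tuple T) -> \bar R}.

Definition cons_measure : set (n.+1.-tuple T) -> \bar R :=
  pushforward (nu \x mu) (@tcons d T n).

Let cons_measure0 : cons_measure set0 = 0.
Proof. by rewrite /cons_measure /pushforward preimage_set0 measure0. Qed.

Let cons_measure_ge0 A : 0 <= cons_measure A.
Proof. by rewrite /cons_measure /pushforward measure_ge0. Qed.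

Let cons_measure_sigma_additive : semi_sigma_additive cons_measure.
Proof.
move=> F mF tF mUF; rewrite /cons_measure /pushforward preimage_bigcup.
have mt (A : set (n.+1.-tuple T)) : measurable A ->
    measurable (@tcons d T n @^-1` A).
  by move=> mA; rewrite -[X in measurable X]setTI; exact: measurable_tcons.
apply: measure_semi_sigma_additive.
- by move=> k; exact: mt.
- apply/trivIsetP => /= i j _ _ ij; rewrite -preimage_setI.
  by move/trivIsetP : tF => /(_ _ _ _ _ ij) ->//; rewrite preimage_set0.
- by rewrite -preimage_bigcup; exact: mt.
Qed.

HB.instance Definition _ := isMeasure.Build _ _ _ cons_measure
  cons_measure0 cons_measure_ge0 cons_measure_sigma_additive.

Let cons_measure_sigma_finite : sigma_finite setT cons_measure.
Proof.
have [F TF Foo] := sigma_finite_product nu mu.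
exists (fun k => @tuncons d T n @^-1` F k).
  by rewrite -preimage_bigcup -TF.
move=> k; have [mF mFoo] := Foo k; split.
  by rewrite -[X in measurable X]setTI; exact: measurable_tuncons.
rewrite /cons_measure /pushforward (_ : _ @^-1` _ = F k)//.
by apply/seteqP; split => x; rewrite /preimage/= tconsK.
Qed.

HB.instance Definition _ := Measure_isSigmaFinite.Build _ _ _ cons_measure
  cons_measure_sigma_finite.

End cons_measure.

Fixpoint tuple_measure d (T : measurableType d) (R : realType)
    (nu : {sigma_finite_measure set T -> \bar R}) (n : nat) :
    {sigma_finite_measure set (n.-tuple T) -> \bar R} :=
  if n is m.+1 then cons_measure nu (tuple_measure nu m)
  else @dirac _ (0.-tuple T) [tuple] R.

Lemma tuple_measure_box d (T : measurableType d) (R : realType)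
    (nu : {sigma_finite_measure set T -> \bar R}) (n : nat)
    (A : 'I_n -> set T) :
  (forall i, measurable (A i)) ->
  (tuple_measure nu n [set x | forall i, A i (tnth x i)]
   = \prod_(i < n) nu (A i))%E.
Proof.
elim: n A => [|n IHn] A mA.
  by rewrite big_ord0 /= diracE mem_set//= => -[].
rewrite big_ord_recl -IHn// -product_measure1E//; last first.
  rewrite (_ : mkset _ =
      \bigcap_(i in setT) ((@tnth n T ^~ i) @^-1` A (lift ord0 i))); last first.
    by apply/seteqP; split => [x xA i _|x xA i]; [exact: xA|exact: (xA i)].
  apply: fin_bigcap_measurable => // i _.
  by rewrite -[X in measurable X]setTI; exact: measurable_tnth.
rewrite /= /cons_measure /pushforward; congr product_measure1.
apply/seteqP; split => [[x t]/= xA|[x t] [/= xA tA] i].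
  split; first exact: (xA ord0).
  by move=> i; have := xA (lift ord0 i); rewrite tnthS.
case: (unliftP ord0 i) => [j ->|->]; last exact: xA.
by rewrite tnthS; exact: tA.
Qed.

(* R^d as the type of d-tuples of reals.  The measurable structure is the
   product of d copies of the Borel sigma-algebra of R, which is the Borel
   sigma-algebra of R^d because R is second countable. *)
Notation euclid R d := (d.-tuple (measurableTypeR R)).

Definition lebesgue_euclid (R : realType) (d : nat) :
    {sigma_finite_measure set (euclid R d) -> \bar R} :=
  tuple_measure (@lebesgue_measure R) d.

Section kernels.
Context (R : realType) (d : nat).
Implicit Types x y z : euclid R d.

Definition vsub x y : euclid R d := [tuple (tnth x i - tnth y i : R) | i < d].

Definition dotv x y : R := \sum_(i < d) (tnth x i : R) * tnth y i.

Definition enorm x : R := Num.sqrt (dotv x x).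

Definition gauss (t : R) x y : R :=
  (4 * pi * t) `^ (- (d%:R / 2)) * expR (- (enorm (vsub y x) ^+ 2 / (4 * t))).

Definition S_pot (V : euclid R d -> R) (t : R) x y : \bar R :=
  (\int[lebesgue_measure]_(s in `]0%R, t[)
     \int[lebesgue_euclid R d]_z
       (gauss s x z * gauss (t - s) z y / gauss t x y * `|V z|)%:E)%E.

Definition S_norm (V : euclid R d -> R) : \bar R :=
  ereal_sup [set e | exists t x y, 0 < t /\ e = S_pot V t x y].

(* Only meant for 3 <= d, where d - 2 and d / 2 - 3 / 2 are nonnegative.  At
   x = 0 the inverse of a ring takes the value 0, which has no effect on
   K_pot since a point is negligible. *)
Definition K_ker x y : R :=
  expR (- ((enorm x * enorm y - dotv x y) / 2)) / enorm x ^+ (d - 2)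
  * (1 + enorm x * enorm y) `^ (d%:R / 2 - 3 / 2).

Definition K_pot (V : euclid R d -> R) x y : \bar R :=
  (\int[lebesgue_euclid R d]_z (`|V z| * K_ker (vsub z x) y)%:E)%E.

Definition K_norm (V : euclid R d -> R) : \bar R :=
  ereal_sup [set e | exists x y, e = K_pot V x y].

End kernels.

(* Main.v *)
Require Import Defs.
From mathcomp Require Import all_boot all_order all_algebra.
From mathcomp Require Import all_classical all_reals all_analysis.
From mathcomp Require Import measurable_realfun ring lra.
Import Order.TTheory GRing.Theory Num.Theory.
Import numFieldNormedType.Exports.
Local Open Scope classical_set_scope.
Local Open Scope ring_scope.

(* With w = z - x and b = (y - x) / t, the ratio of Gaussians in S(V, t, x, y)
   is the Brownian bridge density, a function of A = |w|, D = w . b, B = |b|;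
   as t grows with b fixed it tends to the drifted heat kernel
     (4 pi s)^(-d/2) exp(- |w - s b|^2 / (4 s))
       = exp(- (A B - D) / 2) (4 pi s)^(-d/2) exp(- (A - s B)^2 / (4 s)),
   whose integral over s > 0 is comparable to K(w, b).
   Upper bound: for s <= t / 2 the ratio is at most C K(w, b) q(s), where
   q = - d/ds atan ((A - s B) / sqrt s) has integral at most pi; the times
   s >= t / 2 reduce to this case by exchanging x and y.
   Lower bound: with m = 1 + A B, the times s between A^2 / m and
   A^2 / m + A^2 m^(-3/2) contribute at least c K(w, b) as soon as t is large
   depending on z; then y = x + t b and t goes to infinity. *)

(** * Domination of the drifted heat kernel by the passage density *)

Lemma powR_le_expR (R : realType) (k : R) : 0 <= k ->
  exists2 C : R, 0 < C & forall r : R, 0 <= r -> r `^ k <= C * expR (r / 32).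
Proof.
(* Raising [r <= j * expR (r / j)] to the power [k] gives the exponent [r * k / j]; this [j] makes
   [k / j <= 1 / 32]. *)
move=> k0; pose j : R := 32 * (k + 1).
have j0 : 0 < j by rewrite /j; lra.
exists (j `^ k); first exact: powR_gt0.
move=> r r0.
have rj : r <= j * expR (r / j).
  rewrite -ler_pdivrMl// mulrC.
  by apply: le_trans (expR_ge1Dx _); lra.
apply: (@le_trans _ _ ((j * expR (r / j)) `^ k)).
  by apply: ge0_ler_powR => //; rewrite nnegrE// mulr_ge0// ?ltW ?expR_gt0.
rewrite powRM ?expR_ge0 ?(ltW j0)// ler_pM2l ?powR_gt0// -expRM ler_expR.
rewrite -mulrA ler_wpM2l// -(ler_pM2l j0) mulrA divff ?gt_eqF// mul1r /j.
by lra.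
Qed.

Section passage_density.
Context {R : realType}.
Implicit Types A B s : R.

Definition passage A B s : R := (A - s * B) * s `^ (- (1 / 2)).

(** For [s > 0] this is the [q] of the overview: minus the derivative in [s] of
    [atan (passage A B s)]. *)
Definition passage_density A B s : R :=
  (A + s * B) / 2 * s `^ (- (3 / 2)) / (1 + passage A B s ^+ 2).

Lemma is_derive_passage A B s : 0 < s ->
  is_derive s 1 (passage A B) (- ((A + s * B) / 2 * s `^ (- (3 / 2)))).
Proof.
move=> s0.
have -> : passage A B =
    (fun u => (A - u * B)) * (fun u : R => u `^ (- (1 / 2))).
  by apply/funext.
have h := @is_derive1_powR R (- (1 / 2)) s s0.
apply: is_derive_eq.
rewrite (_ : - (1 / 2) - 1 = - (3 / 2)); last by lra.
rewrite (_ : s `^ (- (1 / 2)) = s * s `^ (- (3 / 2))); last first.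
  rewrite -{2}(powRr1 (ltW s0)) -powRD; last by rewrite (gt_eqF s0) implybT.
  by congr (_ `^ _); lra.
by rewrite scaler0 /GRing.scale/=; field.
Qed.

End passage_density.

(** With [m = 1 + A B] and [r = A^2 / (s m)], the factor [s^(-k)] equals [r^k m^k A^(-2k)]. Half of
    the Gaussian exponent absorbs [r^k], the other half yields the denominator of [passage_density],
    and [A <= A + s B] supplies its numerator. *)
Lemma heat_passage_le (R : realType) (k : R) : 0 <= k ->
  exists2 C : R, 0 < C & forall A B s : R, 0 < A -> 0 <= B -> 0 < s ->
    s `^ (- (k + 3 / 2)) * expR (- ((A - s * B) ^+ 2 / (4 * s))) <=
    C * (A `^ (- (2 * k + 1)) * (1 + A * B) `^ k) * passage_density A B s.
Proof.
move=> k0; have [C C0 HC] := powR_le_expR R k k0.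
(* The two halves of the exponent cost [2 * C] and [8]; the remaining [2] offsets the [/ 2] in
   [passage_density]. *)
exists (C * 32); first lra.
move=> A B s A0 B0 s0.
have AB0 : 0 <= A * B by rewrite mulr_ge0// ltW.
set m := 1 + A * B; have m0 : 0 < m by rewrite /m; lra.
pose r := A ^+ 2 / (s * m).
have r0 : 0 < r by rewrite divr_gt0 ?exprn_gt0// mulr_gt0.
set E := expR (- ((A - s * B) ^+ 2 / (8 * s))).
have sE : s `^ (- (k + 3 / 2)) =
    r `^ k * m `^ k * A `^ (- (2 * k)) * s `^ (- (3 / 2)).
  have -> : s `^ (- (k + 3 / 2)) = s `^ (- k) * s `^ (- (3 / 2)).
    by rewrite -powRD ?(gt_eqF s0) ?implybT//; congr (_ `^ _); lra.
  congr *%R.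
  rewrite -powRM ?ltW// /r.
  rewrite (_ : A ^+ 2 / (s * m) * m = A ^+ 2 * s^-1); last first.
    by field; rewrite !gt_eqF.
  rewrite powRM ?invr_ge0 ?sqr_ge0 ?ltW// -powR_inv1 ?ltW// -!powRrM.
  rewrite mulN1r -powR_mulrn ?ltW// -powRrM mulrAC -powRD; last first.
    by rewrite (gt_eqF A0) implybT.
  by rewrite (_ : 2%:R * k + - (2 * k) = 0) ?powRr0 ?mul1r//; lra.
have EE : expR (- ((A - s * B) ^+ 2 / (4 * s))) = E * E.
  rewrite -expRD; congr expR; field; lra.
(* If [r <= 2], then [E <= 1] is enough. Otherwise [2 s (1 + A B) <= A^2] forces [2 s B <= A], so
   [(A - s B)^2 >= A^2 / 4], and [E] decays at least like [expR (- (A^2 / (32 s)))], where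
   [A^2 / s >= r]. *)
have H1 : r `^ k * E <= 2 * C.
  have E2 : E <= 2 * expR (- (r / 32)).
    have [r2|r2] := leP r 2.
      apply: (@le_trans _ _ 1).
        rewrite -expR0 ler_expR oppr_le0 divr_ge0 ?sqr_ge0//; lra.
      have := expR_ge1Dx (- (r / 32)); lra.
    apply: (@le_trans _ _ (expR (- (r / 32)))); last first.
      by have := expR_gt0 (- (r / 32)); lra.
    rewrite ler_expR lerN2.
    have rs : r * (s * m) = A ^+ 2 by rewrite /r divfK// gt_eqF// mulr_gt0.
    have sm0 : 0 < s * m by rewrite mulr_gt0.
    have sB : 2 * (s * B) <= A.
      rewrite -(ler_pM2l A0) -expr2 -rs.
      have : 2 * (s * m) <= r * (s * m) by rewrite ler_pM2r// ltW.
      rewrite /m; lra.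
    rewrite ler_pdivlMr; last lra.
    have -> : r / 32 * (8 * s) = r * s / 4 by field.
    have rsA : r * s <= A ^+ 2.
      rewrite -rs mulrA ler_peMr; [by []|by rewrite mulr_ge0 ?ltW|].
      by rewrite /m; lra.
    have : (A / 2) ^+ 2 <= (A - s * B) ^+ 2.
      by rewrite ler_sqr ?nnegrE; lra.
    rewrite expr_div_n; lra.
  apply: (@le_trans _ _ (C * expR (r / 32) * (2 * expR (- (r / 32))))).
    by apply: ler_pM; rewrite ?powR_ge0 ?expR_ge0// HC// ltW.
  by rewrite expRN mulrACA divff ?mulr1 ?gt_eqF ?expR_gt0//; lra.
(* Here [E] is [expR (- (passage A B s ^+ 2 / 8))], so [1 + u <= expR u] suffices. *)
have H2 : E <= 8 / (1 + passage A B s ^+ 2).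
  have -> : passage A B s ^+ 2 = (A - s * B) ^+ 2 / s.
    rewrite /passage exprMn; congr *%R.
    rewrite -powR_mulrn ?powR_ge0// -powRrM -(powR_inv1 (ltW s0)).
    by congr (_ `^ _); lra.
  set x := _ / s.
  have x0 : 0 <= x by rewrite divr_ge0 ?sqr_ge0// ltW.
  have xE : E * expR (x / 8) = 1.
    by rewrite /E -expRD (_ : _ + _ = 0) ?expR0// /x; field; rewrite gt_eqF.
  have := expR_ge1Dx (x / 8) => h.
  rewrite ler_pdivlMr; last lra.
  have E0 : 0 < E := expR_gt0 _.
  have : E * (1 + x / 8) <= 1 by rewrite -[leRHS]xE ler_pM2l.
  lra.
rewrite sE EE /passage_density.
set P := passage A B s in H2 *.
have P0 : 0 < 1 + P ^+ 2 by rewrite ltr_pwDl// sqr_ge0.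
set a := A `^ _; set a' := A `^ _; set M := m `^ k; set S := s `^ _.
have aa : a = a' * A.
  rewrite /a /a' -[X in _ = _ * X](powRr1 (ltW A0)) -powRD.
    by congr (_ `^ _); lra.
  by rewrite (gt_eqF A0) implybT.
have a'0 : 0 < a' by rewrite powR_gt0.
have M0 : 0 < M by rewrite powR_gt0.
have S0 : 0 < S by rewrite powR_gt0.
have -> : r `^ k * M * a * S * (E * E) = (M * a * S) * (r `^ k * E * E) by ring.
have -> : C * 32 * (a' * M) * ((A + s * B) / 2 * S / (1 + P ^+ 2)) =
   (M * a' * S) * ((A + s * B) * (2 * C * (8 / (1 + P ^+ 2)))).
  by field; rewrite gt_eqF.
rewrite aa (_ : M * (a' * A) * S * _ =
  (M * a' * S) * (A * (r `^ k * E * E))); last by ring.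
rewrite ler_pM2l ?mulr_gt0//; apply: ler_pM.
- exact: ltW.
- by rewrite !mulr_ge0 ?powR_ge0 ?expR_ge0.
- by rewrite lerDl mulr_ge0// ltW.
- by apply: ler_pM; rewrite ?mulr_ge0 ?powR_ge0 ?expR_ge0.
Qed.

(** * Integrating the passage density over time *)

(** Since [f] may be singular at the ends, the fundamental theorem of calculus is applied on closed
    intervals exhausting []a, b[], where the increment of [F] is at most [2 * M]; monotone
    convergence concludes. *)
Lemma integral_bounded_primitive_le (R : realType) (f F : R -> R) (a b M : R) :
  a < b ->
  (forall x, a < x < b -> 0 <= f x) ->
  (forall x, a < x < b -> {for x, continuous f}) ->
  (forall x, a < x < b -> is_derive x 1 F (f x)) ->
  (forall x, `|F x| <= M) ->
  (\int[lebesgue_measure]_(x in `]a, b[) (f x)%:E <= (2 * M)%:E)%E.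
Proof.
move=> ab f0 cf dF FM.
have ba : 0 < b - a by rewrite subr_gt0.
(* Dividing by at least 3 keeps every closed interval [J n] nondegenerate. *)
pose e n : R := (b - a) / n.+3%:R.
pose J n : set R := `[a + e n, b - e n]%classic.
have e0 n : 0 < e n by rewrite divr_gt0.
have e3 n : e n <= (b - a) / 3.
  by rewrite ler_pM2l// lef_pV2 ?posrE// ler_nat.
have JS n x : J n x -> a < x < b.
  rewrite /J/= in_itv/= => /andP[h1 h2].
  by have := e0 n => ?; apply/andP; split; lra.
have JU : \bigcup_n J n = `]a, b[%classic.
  apply/seteqP; split=> [x [n _ /JS]|x /=]; first by rewrite /= in_itv.
  rewrite in_itv/= => /andP[ax xb].
  pose y := Num.min (x - a) (b - x).
  have y0 : 0 < y by rewrite lt_min !subr_gt0 ax xb.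
  have [n hn] : exists n : nat, (b - a) / y < n%:R.
    exists (Num.truncn ((b - a) / y)).+1; exact: truncnS_gt.
  have en : e n <= y.
    rewrite ler_pdivrMr// mulrC -ler_pdivrMr// ltW// (lt_le_trans hn)//.
    by rewrite ler_nat -addn3 leq_addr.
  have : y <= x - a /\ y <= b - x by rewrite !ge_min !lexx orbT.
  move=> [y1 y2]; exists n => //=.
  by rewrite /J/= in_itv/=; apply/andP; split; lra.
have cJ n : {within J n, continuous f}.
  by apply: continuous_in_subspaceT => x; rewrite inE => /JS; exact: cf.
have mJ n : measurable (J n) by exact: measurable_itv.
have mfJ n : measurable_fun (J n) (fun x => (f x)%:E).
  by apply/measurable_EFinP; apply: subspace_continuous_measurable_fun.
have ndJ : nondecreasing_seq J.
  move=> n m nm; rewrite subsetEset => x.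
  rewrite /J/= !in_itv/= => /andP[h1 h2].
  have : e m <= e n by rewrite ler_pM2l// lef_pV2 ?posrE// ler_nat !ltnS.
  by move=> h; apply/andP; split; lra.
have := @ge0_nondecreasing_set_cvg_integral _ (measurableTypeR R) R J
  (fun x => (f x)%:E) lebesgue_measure ndJ mJ mfJ
  (fun n x Jx => f0 x (JS n x Jx)).
rewrite JU => cvgJ.
rewrite -(cvg_lim _ cvgJ)//; apply: lime_le.
  by apply/cvg_ex; eexists; exact: cvgJ.
apply: nearW => n.
have lt_ab : a + e n < b - e n by have := e3 n; lra.
have dFn (x : R) : x \in `[a + e n, b - e n] -> is_derive x 1 F (f x).
  by move=> xJ; apply: dF; apply: (JS n).
rewrite (@continuous_FTC2 _ f F _ _ lt_ab)//.
- rewrite -EFinB lee_fin.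
  have := FM (b - e n); have := FM (a + e n); rewrite !ler_norml; lra.
- exact: (cJ n).
- have cF (x : R) : x \in `[a + e n, b - e n] -> {for x, continuous F}.
    move=> /dFn h; apply: differentiable_continuous.
    by apply/derivable1_diffP.
  split.
  + by move=> x xJ; have := dFn x (subset_itv_oo_cc xJ).
  + apply: cvg_at_right_filter; apply: cF.
    by rewrite in_itv/= lexx ltW.
  + apply: cvg_at_left_filter; apply: cF.
    by rewrite in_itv/= lexx ltW.
- move=> x xJ; have h := dFn x (subset_itv_oo_cc xJ).
  by rewrite derive1E derive_val.
Qed.

Lemma is_derive_continuous (R : realType) (f : R -> R) (x d : R) :
  is_derive x 1 f d -> {for x, continuous f}.
Proof. by move=> h; apply/differentiable_continuous/derivable1_diffP. Qed.

Section passage_density_integral.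
Context {R : realType}.
Implicit Types A B s t : R.

Lemma passage_density_ge0 A B s : 0 < A -> 0 <= B -> 0 < s ->
  0 <= passage_density A B s.
Proof.
move=> A0 B0 s0; rewrite !mulr_ge0 ?powR_ge0 ?invr_ge0//.
- exact: addr_ge0 (ltW A0) (mulr_ge0 (ltW s0) B0).
- by rewrite addr_ge0 ?sqr_ge0.
Qed.

Lemma continuous_passage_density A B s : 0 < s ->
  {for s, continuous (passage_density A B)}.
Proof.
move=> s0.
have cp : {for s, continuous (passage A B)}.
  exact: (is_derive_continuous _ _ _ _ (is_derive_passage A B s s0)).
have cpow : {for s, continuous (fun u : R => u `^ (- (3 / 2)))}.
  exact: (is_derive_continuous _ _ _ _ (@is_derive1_powR R _ s s0)).
apply: cvgM; first apply: cvgM => //.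
- apply: cvgM; last exact: cvg_cst.
  by apply: cvgD; [exact: cvg_cst|apply: cvgM; [exact: cvg_id|exact: cvg_cst]].
- apply: cvgV; first by rewrite gt_eqF// ltr_pwDl// sqr_ge0.
  by apply: cvgD; [exact: cvg_cst|rewrite expr2; apply: cvgM].
Qed.

Lemma norm_atan_le (x : R) : `|atan x| <= pi / 2.
Proof. by rewrite ler_norml !ltW ?atan_gtNpi2 ?atan_ltpi2. Qed.

Lemma passage_densityE A B s : passage_density A B s =
  (1 + passage A B s ^+ 2)^-1 * ((A + s * B) / 2 * s `^ (- (3 / 2))).
Proof. by rewrite /passage_density mulrC. Qed.

(** The primitive [- atan (passage A B s)] is bounded by [pi / 2], whatever [A], [B] and [t] are. *)
Lemma integral_passage_density_le A B t : 0 < A -> 0 <= B -> 0 < t ->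
  (\int[lebesgue_measure]_(s in `]0%R, t[) (passage_density A B s)%:E
   <= (pi : R)%:E)%E.
Proof.
move=> A0 B0 t0; have -> : pi = 2 * (pi / 2) :> R by field.
apply: (@integral_bounded_primitive_le _ (passage_density A B)
  (fun s => - atan (passage A B s)) 0 t (pi / 2) t0).
- by move=> s /andP[s0 _]; exact: passage_density_ge0.
- by move=> s /andP[s0 _]; exact: continuous_passage_density.
- move=> s /andP[s0 _]; have dp := is_derive_passage A B s s0.
  have dc := is_derive1_comp (is_derive1_atan (passage A B s)) dp.
  apply: (@is_derive_eq _ _ _ _ _ _ _ _ (is_deriveN dc)).
  by rewrite passage_densityE; ring.
- by move=> s; rewrite normrN norm_atan_le.
Qed.

(** The version with reversed clock [t - s], for the second half of the time interval; reversal
    changes the sign of the primitive. *)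
Lemma integral_passage_density_rev_le A B t : 0 < A -> 0 <= B -> 0 < t ->
  (\int[lebesgue_measure]_(s in `]0%R, t[) (passage_density A B (t - s))%:E
   <= (pi : R)%:E)%E.
Proof.
move=> A0 B0 t0; have -> : pi = 2 * (pi / 2) :> R by field.
have drev (s : R) : is_derive s 1 (fun u : R => t - u) (-1).
  by apply: is_derive_eq; rewrite add0r mul1r.
apply: (@integral_bounded_primitive_le _ (fun s => passage_density A B (t - s))
  (fun s => atan (passage A B (t - s))) 0 t (pi / 2) t0).
- by move=> s /andP[_ st]; apply: passage_density_ge0; rewrite ?subr_gt0.
- move=> s /andP[_ st].
  apply: (continuous_comp (is_derive_continuous _ _ _ _ (drev s))).
  by apply: continuous_passage_density; rewrite subr_gt0.
- move=> s /andP[_ st].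
  have ts0 : 0 < t - s by rewrite subr_gt0.
  have dp := is_derive_passage A B (t - s) ts0.
  have dpc := @is_derive1_comp _ (passage A B) (fun u : R => t - u) _ _ _ dp
    (drev s).
  have dc := @is_derive1_comp _ atan (passage A B \o (fun u : R => t - u)) s _ _
    (is_derive1_atan _) dpc.
  apply: (@is_derive_eq _ _ _ _ _ _ _ _ dc).
  by rewrite passage_densityE; ring.
- by move=> s; exact: norm_atan_le.
Qed.

End passage_density_integral.

(** * Measurability of inversion and of the passage density *)

(** The form [x * (x^2)^(-1)] is a product of measurable functions and also gives [0] at [x = 0],
    where inversion is discontinuous. *)
Lemma measurable_invr (R : realType) :
  measurable_fun [set: measurableTypeR R] (@GRing.inv R).
Proof.
rewrite (_ : GRing.inv = fun x : R => x * (x ^+ 2) `^ (-1)).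
  apply: measurable_funM => //; apply: (measurableT_comp (measurable_powR _)).
  exact: measurable_funX.
apply/funext => x; rewrite powR_inv1 ?sqr_ge0//.
by have [->|x0] := eqVneq x 0; rewrite ?invr0 ?mul0r//; field.
Qed.

Lemma measurable_passage_density (R : realType) (A B : R) :
  measurable_fun [set: measurableTypeR R] (passage_density A B).
Proof.
have mp (p : R) : measurable_fun [set: measurableTypeR R] (fun s : R => s `^ p).
  exact: measurable_powR.
apply: measurable_funM; first apply: measurable_funM => //.
  apply: measurable_funM => //; apply: measurable_funD => //.
  exact: measurable_funM.
apply: (measurableT_comp (measurable_invr R)).
apply: measurable_funD => //; apply: measurable_funX.
apply: measurable_funM => //.
by apply: measurable_funB => //; exact: measurable_funM.
Qed.

(** * Pointwise bounds on the bridge density *)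

Lemma le_powRN (R : realType) (x y p : R) : 0 <= p -> 0 < x -> x <= y ->
  y `^ (- p) <= x `^ (- p).
Proof.
move=> p0 x0 xy; have y0 := lt_le_trans x0 xy.
rewrite !powRN lef_pV2 ?posrE ?powR_gt0//.
by apply: ge0_ler_powR => //; rewrite nnegrE ltW.
Qed.

(* The transition density of the Brownian bridge of duration [t], as a function
   of [A = |w|], [D = w . b] and [B = |b|], where [w] is the displacement from
   the starting point and [b] the mean velocity; the quadratic polynomial in
   the exponent is [|w - s b|^2]. *)
Definition bridge {R : realType} (p A D B t s : R) : R :=
  (4 * pi * (s * (t - s) / t)) `^ (- p) *
  expR (- ((A ^+ 2 - 2 * s * D + (s * B) ^+ 2) * t / (4 * s * (t - s)))).

Section bridge.
Context {R : realType}.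
Implicit Types p k A D B t s : R.

(** The polynomial in the exponent is [(A - s B)^2 + 2 s (A B - D)]; divided by [4 s] it splits into
    the heat kernel exponent and [(A B - D) / 2]. As it is nonnegative, the factor
    [t / (t - s) >= 1] only strengthens the decay, while [2 s <= t] gives [s (t - s) / t >= s / 2]
    in the prefactor. *)
Lemma bridge_le k : 0 <= k -> exists2 C : R, 0 < C &
  forall A D B t s, 0 < A -> 0 <= B -> 0 < s -> 2 * s <= t ->
    0 <= A ^+ 2 - 2 * s * D + (s * B) ^+ 2 ->
    bridge (k + 3 / 2) A D B t s <=
    C * (expR (- ((A * B - D) / 2)) * A `^ (- (2 * k + 1)) * (1 + A * B) `^ k)
    * passage_density A B s.
Proof.
move=> k0; have [C C0 HC] := heat_passage_le R k k0.
have p0 : 0 <= k + 3 / 2 by lra.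
have pi0 : 0 < pi :> R := pi_gt0 R.
set p := k + 3 / 2 in p0 *.
exists ((2 * pi) `^ (- p) * C); first by rewrite mulr_gt0// powR_gt0// mulr_gt0.
move=> A D B t s A0 B0 s0 st N0.
have t0 : 0 < t by lra.
have ts0 : 0 < t - s by lra.
have h1 : (4 * pi * (s * (t - s) / t)) `^ (- p) <=
    (2 * pi) `^ (- p) * s `^ (- p).
  rewrite -(powRM _ (ltW _) (ltW s0)) ?mulr_gt0//; apply: le_powRN => //.
    by rewrite !mulr_gt0 ?invr_gt0.
  rewrite (_ : 4 * pi * (s * (t - s) / t) = 2 * pi * s * (2 * (t - s) / t));
    last first.
    by field; rewrite gt_eqF.
  rewrite ler_peMr ?ler_pdivlMr//; last lra.
  by rewrite ltW// !mulr_gt0.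
have h2 : expR (- ((A ^+ 2 - 2 * s * D + (s * B) ^+ 2) * t / (4 * s * (t - s))))
    <= expR (- ((A * B - D) / 2)) * expR (- ((A - s * B) ^+ 2 / (4 * s))).
  rewrite -expRD ler_expR -opprD lerN2.
  set N := (X in X * t / _).
  have -> : (A * B - D) / 2 + (A - s * B) ^+ 2 / (4 * s) = N / (4 * s).
    by rewrite /N; field; rewrite gt_eqF.
  rewrite (_ : N * t / (4 * s * (t - s)) = N / (4 * s) * (t / (t - s))).
    rewrite ler_peMr//; first by rewrite divr_ge0// mulr_ge0// ltW.
    by rewrite ler_pdivlMr//; lra.
  by field; rewrite !gt_eqF.
apply: (le_trans (ler_pM (powR_ge0 _ _) (expR_ge0 _) h1 h2)).
have := HC A B s A0 B0 s0; rewrite -/p.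
set e := expR (- ((A * B - D) / 2)); set e' := expR _.
set P := (2 * pi) `^ _; set S := s `^ _; set a := A `^ _.
set M := (1 + A * B) `^ k; set q := passage_density A B s.
move=> h.
have -> : P * S * (e * e') = P * e * (S * e') by ring.
have -> : P * C * (e * a * M) * q = P * e * (C * (a * M) * q) by ring.
by rewrite ler_pM2l// mulr_gt0 ?expR_gt0// powR_gt0// mulr_gt0.
Qed.

(** The window of times starts at [u = A^2 d^2] and has length [u d]. On it [s <= 2 u] and
    [(A - s B)^2 <= s], and the lower bound on [t] controls the effect of the pinning. *)
Lemma bridge_ge p A D B t s (d := Num.sqrt (1 + A * B)^-1) :
  0 <= p -> 0 < A -> 0 <= B -> A ^+ 2 * (d ^+ 2) < s ->
  s < A ^+ 2 * d ^+ 2 + A ^+ 2 * d ^+ 3 ->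
  4 * A ^+ 2 * (1 + `|A * B - D|) <= t ->
  (8 * pi) `^ (- p) * expR (-1) * expR (- ((A * B - D) / 2)) *
    (A ^+ 2 * (d ^+ 2)) `^ (- p) <= bridge p A D B t s.
Proof.
move=> p0 A0 B0 us su tA.
have AB0 : 0 <= A * B by rewrite mulr_ge0// ltW.
have m0 : 0 < 1 + A * B by lra.
have d0 : 0 < d by rewrite /d sqrtr_gt0 invr_gt0.
have dm : d ^+ 2 * (1 + A * B) = 1.
  by rewrite sqr_sqrtr ?invr_ge0 ?ltW// mulVf// gt_eqF.
have d1 : d <= 1.
  by rewrite -sqrtr1 /d ler_sqrt// invf_le1// lerDl.
have pi0 : 0 < pi :> R := pi_gt0 R.
have AA0 : 0 < A ^+ 2 by rewrite exprn_gt0.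
have dd0 : 0 < d ^+ 2 by rewrite exprn_gt0.
have dd1 : d ^+ 2 <= d by rewrite expr2 ler_piMr// ltW.
set u := A ^+ 2 * d ^+ 2 in us su *.
have u0 : 0 < u by rewrite mulr_gt0.
have s0 : 0 < s by apply: lt_trans us.
have s2u : s <= 2 * u.
  rewrite (le_trans (ltW su))//.
  have : A ^+ 2 * d ^+ 3 <= u by rewrite /u ler_pM2l// exprS ler_piMl// ltW.
  lra.
have uA : u <= A ^+ 2 by rewrite /u ler_piMr ?(ltW AA0)//; lra.
have E0 : 0 <= `|A * B - D| := normr_ge0 _.
have st : 2 * s <= t.
  apply: le_trans tA.
  have : 0 <= A ^+ 2 * `|A * B - D| := mulr_ge0 (ltW AA0) E0.
  lra.
have t0 : 0 < t by lra.
have ts0 : 0 < t - s by lra.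
have h1 : (8 * pi) `^ (- p) * u `^ (- p) <=
    (4 * pi * (s * (t - s) / t)) `^ (- p).
  rewrite -(powRM _ (ltW _) (ltW u0)) ?mulr_gt0//; apply: le_powRN => //.
    by rewrite !mulr_gt0// invr_gt0.
  have : s * ((t - s) / t) <= s.
    by rewrite ler_piMr ?(ltW s0)// ler_pdivrMr//; lra.
  move=> h; rewrite (_ : 8 * pi * u = 4 * pi * (2 * u)); last by ring.
  by rewrite ler_pM2l ?mulr_gt0// -mulrA (le_trans h).
have h2 : expR (-1) * expR (- ((A * B - D) / 2)) <=
  expR (- ((A ^+ 2 - 2 * s * D + (s * B) ^+ 2) * t / (4 * s * (t - s)))).
  rewrite -expRD ler_expR -opprD lerN2.
  (* The first term is at most [2 / 4] and the second at most [1 / 2], which accounts for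
     [expR (-1)]; the third is the one to be kept. *)
  have -> : (A ^+ 2 - 2 * s * D + (s * B) ^+ 2) * t / (4 * s * (t - s)) =
     (A - s * B) ^+ 2 / s * (t / (t - s)) / 4 +
     ((A * B - D) * (s / (t - s)) / 2 + (A * B - D) / 2).
    by field; rewrite !gt_eqF.
  have tts : t / (t - s) <= 2 by rewrite ler_pdivrMr//; lra.
  have tts0 : 0 <= t / (t - s) by rewrite divr_ge0 ?ltW.
  (* Since [d^2 (1 + A B) = 1], one has [u B = A - A d^2]. For [s] between [u] and [u + u d] this
     confines [A - s B] to [[- A d, A d]], and [(A d)^2 = u <= s]. *)
  have AsB : (A - s * B) ^+ 2 <= s.
    apply: le_trans (ltW us).
    have -> : u = (A * d) ^+ 2 by rewrite exprMn.
    have uB : u * B = A - A * d ^+ 2.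
      have -> : u * B = A * (d ^+ 2 * (1 + A * B)) - A * d ^+ 2.
        by rewrite /u; ring.
      by rewrite dm mulr1.
    have sB1 : u * B <= s * B by rewrite ler_wpM2r// ltW.
    have sB2 : s * B <= (u + u * d) * B.
      by rewrite ler_wpM2r// ltW// (lt_le_trans su)// /u; lra.
    have Ad : A * d ^+ 2 <= A * d by rewrite ler_pM2l.
    have Ad0 : 0 <= A * d ^+ 2 by rewrite mulr_ge0// ltW.
    have Ad3 : 0 <= A * d ^+ 2 * d by rewrite mulr_ge0// ltW.
    have sB3 : (u + u * d) * B = (A - A * d ^+ 2) * (1 + d).
      by rewrite -uB; ring.
    rewrite -subr_ge0 subr_sqr mulr_ge0//; lra.
  have h3 : (A - s * B) ^+ 2 / s * (t / (t - s)) <= 1 * 2.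
    apply: ler_pM => //; first by rewrite divr_ge0 ?sqr_ge0 ?ltW.
    by rewrite ler_pdivrMr// mul1r.
  have h4 : (A * B - D) * (s / (t - s)) <= 1.
    apply: (@le_trans _ _ (`|A * B - D| * (s / (t - s)))).
      by rewrite ler_wpM2r ?ler_norm// divr_ge0 ?ltW.
    rewrite mulrA ler_pdivrMr// mul1r.
    have : `|A * B - D| * s <= `|A * B - D| * (2 * A ^+ 2).
      by rewrite ler_wpM2l//; lra.
    lra.
  lra.
have := ler_pM _ _ h1 h2.
rewrite !mulr_ge0 ?powR_ge0 ?expR_ge0// => /(_ isT isT).
by apply: le_trans; rewrite le_eqVlt; apply/orP; left; apply/eqP; ring.
Qed.

End bridge.

(** * Vectors, and the Gaussian ratio as a bridge density *)

Section geometry.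
Context {R : realType} {d : nat}.
Implicit Types (x y z w b : euclid R d) (s t c : R).

Definition vadd x y : euclid R d := [tuple (tnth x i + tnth y i : R) | i < d].

Definition vscale c x : euclid R d := [tuple (c * tnth x i : R) | i < d].

Lemma dotvv_ge0 x : 0 <= dotv x x.
Proof. by apply: sumr_ge0 => i _; rewrite -expr2 sqr_ge0. Qed.

Lemma enorm_ge0 x : 0 <= enorm x.
Proof. exact: sqrtr_ge0. Qed.

Lemma sqr_enorm x : enorm x ^+ 2 = dotv x x.
Proof. by rewrite sqr_sqrtr// dotvv_ge0. Qed.

Lemma enorm_vsub_gt0 x z : z != x -> 0 < enorm (vsub z x).
Proof.
move=> zx; rewrite sqrtr_gt0 lt_def dotvv_ge0 andbT.
apply: contra zx => /eqP h; apply/eqP/eq_from_tnth => i.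
have /(_ i isT)/eqP := psumr_eq0P (fun j _ => sqr_ge0 (tnth (vsub z x) j)) h.
by rewrite mulf_eq0 orbb tnth_mktuple subr_eq0 => /eqP.
Qed.

Lemma enorm_vsubC x y : enorm (vsub x y) = enorm (vsub y x).
Proof.
congr Num.sqrt; apply: eq_bigr => i _; rewrite !tnth_mktuple; ring.
Qed.

Lemma gaussC t x y : gauss t x y = gauss t y x.
Proof. by rewrite /gauss enorm_vsubC. Qed.

Lemma gauss_ge0 t x y : 0 <= gauss t x y.
Proof. by rewrite mulr_ge0 ?powR_ge0 ?expR_ge0. Qed.

(** This is [|w - s b|^2] expanded, as [bridge_le] requires it. *)
Lemma sqr_dist_mean_ge0 w b s :
  0 <= enorm w ^+ 2 - 2 * s * dotv w b + (s * enorm b) ^+ 2.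
Proof.
rewrite exprMn !sqr_enorm /dotv !mulr_sumr -sumrB -big_split/=.
apply: sumr_ge0 => i _.
rewrite (_ : _ + _ = (tnth w i - s * tnth b i) ^+ 2) ?sqr_ge0//; ring.
Qed.

(** Substitute [y - x = t b] and [y - z = t b - w]: the prefactors combine into a power of
    [s (t - s) / t], the exponents into a multiple of [|w - s b|^2]. *)
Lemma gauss_bridge x y z t s (w := vsub z x) (b := vscale t^-1 (vsub y x)) :
  0 < s -> s < t ->
  gauss s x z * gauss (t - s) z y / gauss t x y =
  bridge (d%:R / 2) (enorm w) (dotv w b) (enorm b) t s.
Proof.
move=> s0 st; have t0 := lt_trans s0 st.
have ts0 : 0 < t - s by rewrite subr_gt0.
have pi0 : 0 < pi :> R := pi_gt0 R.
have Eyz : enorm (vsub y z) ^+ 2 =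
    t ^+ 2 * enorm b ^+ 2 - 2 * t * dotv w b + enorm w ^+ 2.
  rewrite !sqr_enorm /dotv !mulr_sumr -sumrB -big_split/=.
  by apply: eq_bigr => i _; rewrite !tnth_mktuple; field; rewrite gt_eqF.
have Eyx : enorm (vsub y x) ^+ 2 = t ^+ 2 * enorm b ^+ 2.
  rewrite !sqr_enorm /dotv !mulr_sumr.
  by apply: eq_bigr => i _; rewrite !tnth_mktuple; field; rewrite gt_eqF.
rewrite /gauss /bridge Eyz Eyx -/w.
set p := d%:R / 2; set A := enorm w; set B := enorm b; set D := dotv w b.
set X := 4 * pi * s; set Y := 4 * pi * (t - s); set Z := 4 * pi * t.
have X0 : 0 < X by rewrite !mulr_gt0.
have Y0 : 0 < Y by rewrite !mulr_gt0.
have Z0 : 0 < Z by rewrite !mulr_gt0.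
have -> : 4 * pi * (s * (t - s) / t) = X * Y / Z.
  by rewrite /X /Y /Z; move: (pi) pi0 => q q0; field; rewrite !gt_eqF.
have -> : (X * Y / Z) `^ (- p) = X `^ (- p) * Y `^ (- p) / Z `^ (- p).
  rewrite powRM ?(ltW (mulr_gt0 X0 Y0)) ?invr_ge0 ?(ltW Z0)//.
  rewrite (powRM _ (ltW X0) (ltW Y0)); congr *%R.
  by rewrite -(powR_inv1 (ltW Z0)) -powRrM mulN1r powRN.
have -> : expR (- ((A ^+ 2 - 2 * s * D + (s * B) ^+ 2) * t / (4 * s * (t - s))))
  = expR (- (A ^+ 2 / (4 * s))) *
    expR (- ((t ^+ 2 * B ^+ 2 - 2 * t * D + A ^+ 2) / (4 * (t - s)))) /
    expR (- (t ^+ 2 * B ^+ 2 / (4 * t))).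
  by rewrite -expRN -!expRD; congr expR; field; rewrite !gt_eqF.
set e1 := expR _; set e2 := expR _; set e3 := expR _.
by rewrite (invfM (_ `^ _)); ring.
Qed.

(** Since [2 k + 1 = d - 2], the kernel is exactly the factor in front of [passage_density] in
    [bridge_le], up to the constant. *)
Lemma K_kerE w b (k := d%:R / 2 - 3 / 2 : R) : (2 <= d)%N -> 0 < enorm w ->
  K_ker w b = expR (- ((enorm w * enorm b - dotv w b) / 2)) *
    enorm w `^ (- (2 * k + 1)) * (1 + enorm w * enorm b) `^ k.
Proof.
move=> d2 w0; rewrite /K_ker -powR_invn ?(ltW w0)//.
by congr (_ * _ `^ _ * _); rewrite natrB// /k; field.
Qed.

Lemma K_ker_ge0 w b : 0 <= K_ker w b.
Proof.
by rewrite !mulr_ge0 ?powR_ge0 ?expR_ge0 ?invr_ge0 ?exprn_ge0 ?enorm_ge0.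
Qed.

End geometry.

(** * Measurability of the kernels, and null singletons *)

Section measurability.
Context dT (T : measurableType dT) {R : realType} {d : nat}.
Implicit Types (f g : T -> euclid R d) (a : T -> measurableTypeR R).

Lemma measurable_vsub f g : measurable_fun setT f -> measurable_fun setT g ->
  measurable_fun setT (fun u => vsub (f u) (g u)).
Proof.
move=> mf mg; apply/measurable_fun_tnthP => i.
rewrite (_ : _ \o _ = fun u => (tnth (f u) i : R) - tnth (g u) i); last first.
  by apply/funext => u /=; rewrite tnth_mktuple.
by apply: measurable_funB; apply: (measurableT_comp (measurable_tnth i)).
Qed.

Lemma measurable_dotv f g : measurable_fun setT f -> measurable_fun setT g ->
  measurable_fun setT (fun u => dotv (f u) (g u)).
Proof.
move=> mf mg; apply: measurable_sum => i.
by apply: measurable_funM; apply: (measurableT_comp (measurable_tnth i)).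
Qed.

Lemma measurable_enorm f : measurable_fun setT f ->
  measurable_fun setT (fun u => enorm (f u)).
Proof.
move=> mf; apply: (measurableT_comp (f := @Num.sqrt R)).
  by apply: continuous_measurable_fun; exact: sqrt_continuous.
exact: measurable_dotv.
Qed.

Lemma measurable_gauss a f g : measurable_fun setT a ->
  measurable_fun setT f -> measurable_fun setT g ->
  measurable_fun setT (fun u => gauss (a u) (f u) (g u)).
Proof.
move=> ma mf mg; apply: measurable_funM.
  by apply: (measurableT_comp (measurable_powR _)); exact: measurable_funM.
apply: (measurableT_comp (@measurable_expR R)).
apply: measurableT_comp => //; apply: measurable_funM.
  by apply/measurable_funX/measurable_enorm/measurable_vsub.
by apply: (measurableT_comp (measurable_invr R)); exact: measurable_funM.
Qed.

Lemma measurable_K_ker f g : measurable_fun setT f -> measurable_fun setT g ->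
  measurable_fun setT (fun u => K_ker (f u) (g u)).
Proof.
move=> mf mg.
have mm : measurable_fun setT (fun u => enorm (f u) * enorm (g u)).
  by apply: measurable_funM; exact: measurable_enorm.
apply: measurable_funM; first apply: measurable_funM.
- apply: (measurableT_comp (@measurable_expR R)).
  apply: measurableT_comp => //; apply: measurable_funM => //.
  by apply: measurable_funB => //; exact: measurable_dotv.
- apply: (measurableT_comp (measurable_invr R)).
  by apply: measurable_funX; exact: measurable_enorm.
- apply: (measurableT_comp (measurable_powR _)).
  exact: measurable_funD.
Qed.

End measurability.

Lemma measurable_euclid_set1 (R : realType) (d : nat) (x : euclid R d) :
  measurable [set x].
Proof.
rewrite (_ : [set x] = \bigcap_(i in [set: 'I_d])
    ((fun z : euclid R d => tnth z i) @^-1` [set tnth x i])).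
  apply: fin_bigcap_measurable => // i _.
  rewrite -[X in measurable X]setTI.
  exact: (@measurable_tnth _ (measurableTypeR R) d i).
apply/seteqP; split=> [z -> //|z h].
by apply/eq_from_tnth => i; exact: h.
Qed.

(** A point is a box with degenerate sides. This lets the upper bound ignore [z = x] and [z = y]. *)
Lemma lebesgue_euclid_set1 (R : realType) (d : nat) (x : euclid R d) :
  (0 < d)%N -> lebesgue_euclid R d [set x] = 0%E.
Proof.
move=> d0.
have -> : [set x] = [set z | forall i, [set tnth x i] (tnth z i)].
  apply/seteqP; split=> [z -> //|z h].
  by apply/eq_from_tnth => i; exact: h.
rewrite (@tuple_measure_box _ _ _ (@lebesgue_measure R) d
  (fun i => [set tnth x i]))//.
case: d d0 x => // d _ x.
rewrite big_ord_recl [X in (X * _)%E](lebesgue_measure_set1 (tnth x ord0)).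
by rewrite mul0e.
Qed.

(** * Exchanging the time and space integrals *)

Section tonelli.
Context {R : realType} {d : nat}.
Implicit Types (x y z b : euclid R d) (V : euclid R d -> R) (t : R).

Definition gauss_ratio t x y (s : R) z : R :=
  gauss s x z * gauss (t - s) z y / gauss t x y.

Lemma gauss_ratio_ge0 t x y s z : 0 <= gauss_ratio t x y s z.
Proof.
by apply: divr_ge0; [apply: mulr_ge0|]; exact: gauss_ge0.
Qed.

Lemma measurable_gauss_ratio t x y :
  measurable_fun [set: measurableTypeR R * euclid R d]
    (fun p => gauss_ratio t x y p.1 p.2).
Proof.
apply: measurable_funM => //.
apply: measurable_funM; apply: measurable_gauss => //.
exact: measurable_funB.
Qed.

Lemma measurable_gauss_ratio1 t x y z (X : set (measurableTypeR R)) :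
  measurable_fun X (gauss_ratio t x y ^~ z).
Proof.
apply: measurable_funTS.
exact: (measurable_fun_pair1 z (measurable_gauss_ratio t x y)).
Qed.

(** The indicator carries the time interval, so that both integrals run over whole spaces. *)
Let S_integrand V t x y (p : measurableTypeR R * euclid R d) : \bar R :=
  (gauss_ratio t x y p.1 p.2 * `|V p.2| * \1_`]0, t[%classic p.1)%:E.

Let measurable_S_integrand V t x y : measurable_fun setT V ->
  measurable_fun setT (S_integrand V t x y).
Proof.
move=> mV; apply/measurable_EFinP; apply: measurable_funM.
  apply: measurable_funM; first exact: measurable_gauss_ratio.
  apply: (measurableT_comp (@normr_measurable R setT)).
  exact: (measurableT_comp mV).
have mI : measurable_fun [set: measurableTypeR R] (\1_`]0, t[%classic : R -> R).
  by apply: measurable_indic; exact: measurable_itv.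
exact: (measurableT_comp mI measurable_fst).
Qed.

Let S_integrand_ge0 V t x y p : (0 <= S_integrand V t x y p)%E.
Proof.
rewrite lee_fin; apply: mulr_ge0; last by rewrite indicE.
by apply: mulr_ge0 => //; exact: gauss_ratio_ge0.
Qed.

(** For [t > 0], the Green function of the bridge: its expected occupation time density at [z]. *)
Definition occupation t x y z : \bar R :=
  (\int[lebesgue_measure]_(s in `]0%R, t[) (gauss_ratio t x y s z)%:E)%E.

Let S_integrand1 V t x y z :
  (\int[@lebesgue_measure R]_s S_integrand V t x y (s, z) =
   occupation t x y z * `|V z|%:E)%E.
Proof.
rewrite /occupation -ge0_integralZr//; last 2 first.
- by apply/measurable_EFinP; exact: measurable_gauss_ratio1.
- by move=> s _; rewrite lee_fin gauss_ratio_ge0.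
rewrite [RHS]integral_mkcond; apply: eq_integral => s _.
rewrite /S_integrand patchE/= indicE; case: ifPn => _.
  by rewrite mulr1 EFinM.
by rewrite mulr0.
Qed.

(** By Tonelli the time integral moves inside, so bounds on [occupation] that are pointwise in [z]
    and independent of [V] suffice. *)
Lemma S_potE V t x y : measurable_fun setT V ->
  S_pot V t x y =
  (\int[lebesgue_euclid R d]_z (occupation t x y z * `|V z|%:E))%E.
Proof.
move=> mV.
transitivity (\int[@lebesgue_measure R]_s
    \int[lebesgue_euclid R d]_z S_integrand V t x y (s, z))%E.
  rewrite /S_pot integral_mkcond; apply: eq_integral => s _.
  rewrite patchE; case: ifPn => st; last first.
    rewrite integral0_eq// => z _.
    by rewrite /S_integrand/= indicE (negbTE st) mulr0.
  apply: eq_integral => z _.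
  by rewrite /S_integrand/= indicE st mulr1.
rewrite fubini_tonelli; last 2 first.
- exact: measurable_S_integrand.
- exact: S_integrand_ge0.
by apply: eq_integral => z _; exact: S_integrand1.
Qed.

Lemma occupation_ge0 t x y z : (0 <= occupation t x y z)%E.
Proof. by apply: integral_ge0 => s _; rewrite lee_fin gauss_ratio_ge0. Qed.

(** The product is the time integral of a jointly measurable nonnegative function. *)
Lemma measurable_occupationM V t x y : measurable_fun setT V ->
  measurable_fun setT (fun z => occupation t x y z * `|V z|%:E)%E.
Proof.
move=> mV.
have := measurable_fun_fubini_tonelli_G (m1 := @lebesgue_measure R) _
  (measurable_S_integrand V t x y mV) (S_integrand_ge0 V t x y).
by congr measurable_fun; apply/funext => z; exact: S_integrand1.
Qed.

End tonelli.

(** * Upper bound on the occupation density *)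

Section occupation_bounds.
Context {R : realType} {d : nat}.
Context (hd : (3 <= d)%N).
Implicit Types (x y z b : euclid R d) (t s : R).

Let k : R := d%:R / 2 - 3 / 2.

Let k_ge0 : 0 <= k.
Proof.
have : 3 <= d%:R :> R by rewrite ler_nat.
by rewrite /k; lra.
Qed.

Let kE : d%:R / 2 = k + 3 / 2.
Proof. by rewrite /k; lra. Qed.

(** Time reversal: run backwards, the bridge from [x] to [y] is the bridge from [y] to [x]. *)
Lemma gauss_ratioC t x y s z :
  gauss_ratio t x y s z = gauss_ratio t y x (t - s) z.
Proof.
rewrite /gauss_ratio subKr [gauss t x y]gaussC [gauss s x z]gaussC.
by rewrite [gauss (t - s) z y]gaussC [X in X / _]mulrC.
Qed.

Lemma gauss_ratio_le : exists2 C : R, 0 < C &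
  forall t x y s z, z != x -> 0 < s -> 2 * s <= t ->
  gauss_ratio t x y s z <=
    C * K_ker (vsub z x) (vscale t^-1 (vsub y x)) *
    passage_density (enorm (vsub z x)) (enorm (vscale t^-1 (vsub y x))) s.
Proof.
have [C C0 HC] := bridge_le k k_ge0; exists C => // t x y s z zx s0 st.
have w0 := enorm_vsub_gt0 x z zx.
rewrite /gauss_ratio gauss_bridge//; last lra.
rewrite K_kerE//; last exact: ltnW.
rewrite -/k kE; apply: HC => //; first exact: enorm_ge0.
exact: sqr_dist_mean_ge0.
Qed.

(** For [2 s <= t] the ratio is bounded from the starting point [x], for later times from [y] by
    reversal. The sum of the two nonnegative bounds dominates throughout []0, t[], and each passage
    density integrates to at most [pi]. *)
Lemma occupation_le : exists2 C : R, 0 < C &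
  forall t x y z, 0 < t -> z != x -> z != y ->
  (occupation t x y z <=
    (C * (K_ker (vsub z x) (vscale t^-1 (vsub y x)) +
          K_ker (vsub z y) (vscale t^-1 (vsub x y))))%:E)%E.
Proof.
have half_le t s : t < 2 * s -> 2 * (t - s) <= t by lra.
have [C C0 HC] := gauss_ratio_le.
have pi0 : 0 < pi :> R := pi_gt0 R.
exists (C * pi); first exact: mulr_gt0.
move=> t x y z t0 zx zy.
set b := vscale _ _; set b' := vscale _ _.
set w := vsub z x; set w' := vsub z y.
have w0 : 0 < enorm w := enorm_vsub_gt0 x z zx.
have w'0 : 0 < enorm w' := enorm_vsub_gt0 y z zy.
have K0 := K_ker_ge0 w b; have K'0 := K_ker_ge0 w' b'.
pose q s := passage_density (enorm w) (enorm b) s.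
pose q' s := passage_density (enorm w') (enorm b') (t - s).
have mI : measurable (`]0, t[%classic : set (measurableTypeR R)).
  exact: measurable_itv.
have mq : measurable_fun (`]0, t[%classic : set (measurableTypeR R))
    (EFin \o q).
  apply/measurable_EFinP; apply: measurable_funTS.
  exact: measurable_passage_density.
have mq' : measurable_fun (`]0, t[%classic : set (measurableTypeR R))
    (EFin \o q').
  apply/measurable_EFinP; apply: measurable_funTS.
  apply: (measurableT_comp (measurable_passage_density R _ _)).
  exact: measurable_funB.
have q0 s : `]0, t[%classic s -> (0 <= (q s)%:E)%E.
  rewrite /= in_itv/= lee_fin => /andP[s0 st].
  exact: passage_density_ge0 w0 (enorm_ge0 b) s0.
have q'0 s : `]0, t[%classic s -> (0 <= (q' s)%:E)%E.
  rewrite /= in_itv/= lee_fin => /andP[s0 st].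
  apply: passage_density_ge0 w'0 (enorm_ge0 b') _.
  by rewrite subr_gt0.
pose c := C * K_ker w b; pose c' := C * K_ker w' b'.
have c0 : 0 <= c := mulr_ge0 (ltW C0) K0.
have c'0 : 0 <= c' := mulr_ge0 (ltW C0) K'0.
have cq0 s : `]0, t[%classic s -> (0 <= c%:E * (q s)%:E)%E.
  by move=> sI; exact: mule_ge0 (c0 : (0 <= c%:E)%E) (q0 s sI).
have cq'0 s : `]0, t[%classic s -> (0 <= c'%:E * (q' s)%:E)%E.
  by move=> sI; exact: mule_ge0 (c'0 : (0 <= c'%:E)%E) (q'0 s sI).
apply: (@le_trans _ _ (\int[@lebesgue_measure R]_(s in `]0%R, t[)
    (c%:E * (q s)%:E + c'%:E * (q' s)%:E))%E).
  apply: ge0_le_integral.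
  - exact: mI.
  - by move=> s _; rewrite lee_fin gauss_ratio_ge0.
  - by apply/measurable_EFinP; exact: measurable_gauss_ratio1.
  - exact: emeasurable_funD (measurable_funeM _ mq) (measurable_funeM _ mq').
  move=> s sI; have {}cq0 := cq0 s sI; have {}cq'0 := cq'0 s sI.
  move: sI; rewrite /= in_itv/= => /andP[s0 st].
  have [h|h] := leP (2 * s) t.
    apply: le_trans (leeDl _ cq'0).
    by rewrite -EFinM lee_fin; exact: HC t x y s z zx s0 h.
  rewrite gauss_ratioC; apply: le_trans (leeDr _ cq0).
  have ts0 : 0 < t - s by rewrite subr_gt0.
  by rewrite -EFinM lee_fin; exact: HC t y x (t - s) z zy ts0 (half_le t s h).
rewrite (ge0_integralD _ mI cq0 (measurable_funeM _ mq) cq'0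
  (measurable_funeM _ mq')).
rewrite (ge0_integralZl _ mI mq q0 (c0 : (0 <= c%:E)%E)).
rewrite (ge0_integralZl _ mI mq' q'0 (c'0 : (0 <= c'%:E)%E)).
rewrite mulrDr EFinD /c /c'; apply: leeD.
  rewrite [C * pi * _]mulrAC [leRHS]EFinM.
  apply: (lee_wpmul2l (c0 : (0 <= c%:E)%E)).
  exact: integral_passage_density_le w0 (enorm_ge0 b) t0.
rewrite [C * pi * _]mulrAC [leRHS]EFinM.
apply: (lee_wpmul2l (c'0 : (0 <= c'%:E)%E)).
exact: integral_passage_density_rev_le w'0 (enorm_ge0 b') t0.
Qed.

End occupation_bounds.

(** * Lower bound on the occupation density at fixed mean velocity *)

Section lower.
Context {R : realType} {d : nat}.
Context (hd : (3 <= d)%N).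
Implicit Types (x y z b : euclid R d) (t s : R).

Let k : R := d%:R / 2 - 3 / 2.

Let kE : d%:R / 2 = k + 3 / 2.
Proof. by rewrite /k; lra. Qed.

Let p_ge0 : 0 <= d%:R / 2 :> R.
Proof. by rewrite divr_ge0. Qed.

(* Bridges from [x] with mean velocity [b] and duration at least [start_cutoff]
   feel only a bounded factor from the pinning while they pass near [z]. *)
Definition start_cutoff x b z : R :=
  4 * enorm (vsub z x) ^+ 2 *
  (1 + `|enorm (vsub z x) * enorm b - dotv (vsub z x) b|).

Lemma vadd_vscaleK t x b : t != 0 ->
  vscale t^-1 (vsub (vadd x (vscale t b)) x) = b.
Proof.
move=> t0; apply/eq_from_tnth => i; rewrite !tnth_mktuple; field.
exact: t0.
Qed.

(** The bound of [bridge_ge] is constant in [s]; multiplied by the length of its window of times, it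
    becomes the kernel. *)
Lemma occupation_ge t x b z : 0 < t -> z != x -> start_cutoff x b z <= t ->
  (((8 * pi) `^ (- (d%:R / 2)) * expR (-1) * K_ker (vsub z x) b)%:E <=
    occupation t x (vadd x (vscale t b)) z)%E.
Proof.
move=> t0 zx tz; have w0 := enorm_vsub_gt0 x z zx.
rewrite K_kerE//; last exact: ltnW.
set y := vadd _ _; have by_ : vscale t^-1 (vsub y x) = b.
  by rewrite vadd_vscaleK// gt_eqF.
set c := _ * expR (-1).
set A := enorm (vsub z x) in w0 tz *; set B := enorm b.
set D := dotv (vsub z x) b.
have B0 : 0 <= B := enorm_ge0 b.
have AB0 : 0 <= A * B by rewrite mulr_ge0// ltW.
pose m := 1 + A * B; have m0 : 0 < m by rewrite /m; lra.
pose e := Num.sqrt m^-1; have e0 : 0 < e by rewrite sqrtr_gt0 invr_gt0.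
have e1 : e <= 1 by rewrite -sqrtr1 /e ler_sqrt// invf_le1// lerDl.
have AA0 : 0 < A ^+ 2 by rewrite exprn_gt0.
set u := A ^+ 2 * e ^+ 2; have u0 : 0 < u by rewrite mulr_gt0// exprn_gt0.
set v := A ^+ 2 * e ^+ 3; have v0 : 0 < v by rewrite mulr_gt0// exprn_gt0.
(* Both [u] and [v] are at most [A^2], while the cutoff is at least [4 A^2]; the window thus lies
   inside []0, t[]. *)
have uvt : u + v < t.
  have uA : u <= A ^+ 2 by rewrite ler_piMr ?(ltW AA0)// exprn_ile1// ltW.
  have vA : v <= A ^+ 2 by rewrite ler_piMr ?(ltW AA0)// exprn_ile1// ltW.
  apply: lt_le_trans tz.
  have : 0 <= A ^+ 2 * `|A * B - D| by rewrite mulr_ge0// ltW.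
  rewrite /start_cutoff -/A -/B -/D; lra.
set f := expR (- ((A * B - D) / 2)).
(* As [u = A^2 / m] and [v = A^2 m^(-3/2)], the product [u^(-d/2) v] has exponent [2 - d] in [A] and
   [d/2 - 3/2] in [m]. *)
have cE : c * (f * A `^ (- (2 * k + 1)) * m `^ k) =
    c * f * u `^ (- (d%:R / 2)) * v.
  have ep : e = m `^ (- (1 / 2)).
    rewrite /e -powR12_sqrt ?invr_ge0 ?(ltW m0)//.
    rewrite -(powR_inv1 (ltW m0)) -powRrM; congr (_ `^ _); lra.
  have mne (q : R) : (q == 0) ==> (m != 0) by rewrite (gt_eqF m0) implybT.
  have Ane (q : R) : (q == 0) ==> (A != 0) by rewrite (gt_eqF w0) implybT.
  have -> : u = A `^ 2 * m `^ (- 1).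
    rewrite /u ep -!powR_mulrn ?powR_ge0 ?(ltW w0)// -powRrM.
    by congr (_ * _ `^ _); lra.
  have -> : v = A `^ 2 * m `^ (- (3 / 2)).
    rewrite /v ep -!powR_mulrn ?powR_ge0 ?(ltW w0)// -powRrM.
    by congr (_ * _ `^ _); lra.
  rewrite powRM ?powR_ge0// -!powRrM.
  transitivity (c * f * (A `^ (2 * - (d%:R / 2)) * A `^ 2) *
     (m `^ (- 1 * - (d%:R / 2)) * m `^ (- (3 / 2)))); last by ring.
  rewrite -(powRD (Ane _)) -(powRD (mne _)).
  rewrite (_ : 2 * - (d%:R / 2) + 2 = - (2 * k + 1)); last first.
    by rewrite kE; lra.
  rewrite (_ : - 1 * - (d%:R / 2) + - (3 / 2) = k); last by rewrite kE; lra.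
  by ring.
rewrite cE.
apply: (@le_trans _ _ (\int[@lebesgue_measure R]_(s in `]u, (u + v)%R[)
    (c * f * u `^ (- (d%:R / 2)))%:E)%E).
  rewrite integral_cst//=.
  rewrite lebesgue_measure_itv/= lte_fin ltrDl v0 -EFinB -EFinM lee_fin.
  by rewrite (addrC u) addrK.
apply: (@le_trans _ _ (\int[@lebesgue_measure R]_(s in `]u, (u + v)%R[)
    (gauss_ratio t x y s z)%:E)%E).
  apply: ge0_le_integral => //.
  - by move=> s _; rewrite lee_fin !mulr_ge0 ?powR_ge0 ?expR_ge0.
  - by apply/measurable_EFinP; exact: measurable_gauss_ratio1.
  move=> s /=; rewrite in_itv/= => /andP[us su]; rewrite lee_fin.
  rewrite /gauss_ratio gauss_bridge; last 2 first.
  - exact: lt_trans us.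
  - exact: lt_trans su uvt.
  rewrite by_ -/A -/B -/D.
  exact: bridge_ge.
apply: ge0_subset_integral => //.
- by apply/measurable_EFinP; exact: measurable_gauss_ratio1.
- by move=> s _; rewrite lee_fin gauss_ratio_ge0.
- move=> s /=; rewrite !in_itv/= => /andP[us su].
  by rewrite (lt_trans u0 us) (lt_trans su uvt).
Qed.

End lower.

(** * Comparison of the two norms *)

Section main.
Context {R : realType} {d : nat}.
Context (hd : (3 <= d)%N).
Implicit Types (x y z b : euclid R d) (t s : R) (V : euclid R d -> R).

Lemma measurable_K_integrand V x b : measurable_fun setT V ->
  measurable_fun setT (fun z => (`|V z| * K_ker (vsub z x) b)%:E).
Proof.
move=> mV; apply/measurable_EFinP; apply: measurable_funM.
  exact: (measurableT_comp (@normr_measurable R setT)).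
by apply: measurable_K_ker => //; exact: measurable_vsub.
Qed.

Lemma K_integrand_ge0 V x b z : (0 <= (`|V z| * K_ker (vsub z x) b)%:E)%E.
Proof. by rewrite lee_fin mulr_ge0// K_ker_ge0. Qed.

Lemma S_pot_le_S_norm V t x y : 0 < t -> (S_pot V t x y <= S_norm V)%E.
Proof. by move=> t0; apply: ereal_sup_ubound; exists t, x, y. Qed.

Lemma K_pot_le_K_norm V x b : (K_pot V x b <= K_norm V)%E.
Proof. by apply: ereal_sup_ubound; exists x, b. Qed.

(** Integrating [occupation_le] against [|V|] gives two values of [K_pot], based at [x] and at [y]
    with opposite velocities; hence the factor 2. *)
Lemma S_norm_le : exists2 C : R, 0 < C &
  forall V, measurable_fun setT V -> (S_norm V <= C%:E * K_norm V)%E.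
Proof.
have [C C0 HC] := @occupation_le R d hd.
exists (C * 2); first by rewrite mulr_gt0.
move=> V mV; apply: ge_ereal_sup => _ [t [x [y [t0 ->]]]].
rewrite S_potE//.
set b := vscale t^-1 (vsub y x); set b' := vscale t^-1 (vsub x y).
have mK := measurable_K_integrand V x b mV.
have mK' := measurable_K_integrand V y b' mV.
pose F z := ((`|V z| * K_ker (vsub z x) b)%:E +
             (`|V z| * K_ker (vsub z y) b')%:E)%E.
have mF : measurable_fun setT F := emeasurable_funD mK mK'.
have F0 z : (0 <= F z)%E by rewrite adde_ge0// K_integrand_ge0.
apply: (@le_trans _ _ (\int[lebesgue_euclid R d]_z (C%:E * F z))%E).
  apply: ae_ge0_le_integral.
  - exact: measurableT.
  - by move=> z _; rewrite mule_ge0 ?occupation_ge0.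
  - exact: measurable_occupationM.
  - by move=> z _; rewrite mule_ge0// lee_fin ltW.
  - exact: measurable_funeM.
  (* [occupation_le] says nothing at these two points, so the comparison is only almost
     everywhere. *)
  exists ([set x] `|` [set y]); split.
  - by apply: measurableU; exact: measurable_euclid_set1.
  - apply/eqP; rewrite -measure_le0.
    apply: (le_trans (measureU2 _ _ _)); [exact: measurable_euclid_set1..|].
    have d0 : (0 < d)%N by exact: leq_trans hd.
    rewrite [X in (X + _)%E](lebesgue_euclid_set1 R d x d0).
    by rewrite [X in (_ + X)%E](lebesgue_euclid_set1 R d y d0) adde0.
  - move=> z /= h; apply: contrapT => /not_orP[/eqP zx /eqP zy]; apply: h => _.
    rewrite muleC /F -EFinD -mulrDr -EFinM mulrCA EFinM.
    apply: lee_wpmul2l; first by rewrite lee_fin.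
    exact: HC.
rewrite ge0_integralZl//; last by rewrite lee_fin ltW.
rewrite /F (ge0_integralD _ measurableT
  (fun z _ => K_integrand_ge0 V x b z) mK
  (fun z _ => K_integrand_ge0 V y b' z) mK').
rewrite EFinM -muleA; apply: lee_wpmul2l; first by rewrite lee_fin ltW.
rewrite mule_natl mule2n; apply: leeD; exact: K_pot_le_K_norm.
Qed.

(** For fixed [x] and [b], the sets [E n] where [start_cutoff] is at most [n + 1] increase to the
    whole space. On each of them the bridge of duration [n + 1] with mean velocity [b] gives the
    bound, and monotone convergence recovers [K_pot V x b]. *)
Lemma S_norm_ge : exists2 c : R, 0 < c &
  forall V, measurable_fun setT V -> (c%:E * K_norm V <= S_norm V)%E.
Proof.
pose c : R := (8 * pi) `^ (- (d%:R / 2)) * expR (-1).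
have pi0 : 0 < pi :> R := pi_gt0 R.
have c0 : 0 < c by rewrite mulr_gt0 ?expR_gt0// powR_gt0// mulr_gt0.
exists c => // V mV.
rewrite -lee_pdivlMl//; apply: ge_ereal_sup => _ [x [b ->]].
rewrite lee_pdivlMl// /K_pot -ge0_integralZl//; last 3 first.
- exact: measurable_K_integrand.
- by move=> z _; exact: K_integrand_ge0.
- by rewrite lee_fin ltW.
pose E (n : nat) := [set z | start_cutoff x b z <= n.+1%:R].
pose h z := (c%:E * (`|V z| * K_ker (vsub z x) b)%:E)%E.
have h0 z : (0 <= h z)%E by rewrite mule_ge0 ?K_integrand_ge0// lee_fin ltW.
have mh : measurable_fun setT h.
  by apply: emeasurable_funM => //; exact: measurable_K_integrand.
have mE n : measurable (E n).
  rewrite -[E n]setTI.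
  have mc : measurable_fun setT (start_cutoff x b).
    have mw : measurable_fun [set: euclid R d] (fun z => vsub z x).
      exact: measurable_vsub.
    have mA := measurable_enorm _ _ _ mw.
    apply: measurable_funM.
      by apply: measurable_funM => //; exact: measurable_funX.
    apply: measurable_funD => //.
    apply: (measurableT_comp (@normr_measurable R setT)).
    apply: measurable_funB; first exact: measurable_funM.
    exact: measurable_dotv.
  have := measurable_fun_ler mc (measurable_cst (n.+1%:R : R)).
  move=> /(_ measurableT [set true]); exact.
have ndE : nondecreasing_seq E.
  move=> n m nm; rewrite subsetEset => z /= /le_trans; apply.
  by rewrite ler_nat ltnS.
have UE : \bigcup_n E n = setT.
  apply/seteqP; split=> // z _; exists (Num.truncn (start_cutoff x b z)) => //=.
  by rewrite /E/= ltW// truncnS_gt.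
have cvgE := @ge0_nondecreasing_set_cvg_integral _ _ _ E h (lebesgue_euclid R d)
  ndE mE (fun n => measurable_funTS mh) (fun n z _ => h0 z).
rewrite UE in cvgE; rewrite -(cvg_lim _ cvgE)//.
apply: lime_le; first by apply/cvg_ex; eexists; exact: cvgE.
(* The duration equals the bound that defines [E n], as [occupation_ge] requires. *)
apply: nearW => n; pose t : R := n.+1%:R; have t0 : 0 < t by [].
apply: le_trans (S_pot_le_S_norm V t x (vadd x (vscale t b)) t0).
rewrite S_potE//.
apply: (@le_trans _ _ (\int[lebesgue_euclid R d]_(z in E n)
    (occupation t x (vadd x (vscale t b)) z * `|V z|%:E))%E); last first.
  apply: ge0_subset_integral => //; first exact: measurable_occupationM.
  by move=> z _; rewrite mule_ge0 ?occupation_ge0.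
apply: ge0_le_integral => //.
- exact: measurable_funTS.
- by apply: measurable_funTS; exact: measurable_occupationM.
move=> z Ez; rewrite /h -EFinM mulrCA mulrC EFinM.
(* At [z = x] the kernel has the default value [0], because [0 ^+ (d - 2)] is [0] for [d >= 3]. *)
have [->|zx] := eqVneq z x.
  have -> : K_ker (vsub x x) b = 0.
    rewrite /K_ker (_ : enorm _ = 0); last first.
      rewrite /enorm /dotv big1 ?sqrtr0// => i _.
      by rewrite tnth_mktuple subrr mul0r.
    by rewrite expr0n subn_eq0 leqNgt hd invr0 mulr0 mul0r.
  by rewrite mulr0 mul0e mule_ge0 ?occupation_ge0.
by apply: lee_wpmul2r; [rewrite lee_fin|exact: occupation_ge].
Qed.

End main.

Theorem theorem1p2 (R : realType) (d : nat) (hd : (3 <= d)%N) :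
  exists M1 M2 : R, 0 < M1 /\ 0 < M2 /\
    forall V : euclid R d -> R, measurable_fun [set: euclid R d] V ->
      (M1%:E * K_norm V <= S_norm V)%E /\ (S_norm V <= M2%:E * K_norm V)%E.
Proof.
have [M1 M10 H1] := @S_norm_ge R d hd; have [M2 M20 H2] := @S_norm_le R d hd.
exists M1, M2; split=> //; split=> // V mV.
by split; [exact: H1|exact: H2].
Qed.
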